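(* Let $X$ be a reflexive smooth Banach space over $\mathbb{C}$ and $T\in B(X)$. If $\lambda\in\sigma(T)$ is such that $T-\lambda I$ is normal, then $\lambda\in\sigma_{app}(T)$.
   Context: $B(X)$ is the space of bounded linear operators on $X$, $S_X=\{x\in X:\|x\|=1\}$, $X^*$ is the space of bounded linear functionals on $X$. $X$ is smooth if every $x\in S_X$ admits a unique $x^*\in S_{X^*}$ with $x^*(x)=1$. The duality mapping $J:X\to X^*$ of a smooth Banach space assigns to each $x$ the unique functional $J(x)$ with $\|J(x)\|=\|x\|$ and $J(x)(x)=\|x\|^2$; write $Jx=J(x)$. For $T\in B(X)$ the transpose $T':X^*\to X^*$ is $(T'f)(x)=f(Tx)$. An operator $T\in B(X)$ on a smooth Banach space is called normal if $\|Tx\|=\|T'Jx\|$ for all $x\in X$. $\sigma(T)$ is the set of $\lambda\in\mathbb{C}$ for which $T-\lambda I$ does not have a bounded inverse; $\sigma_{app}(T)$ is the set of $\lambda\in\mathbb{C}$ for which $T-\lambda I$ is not bounded below. *)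

(* Defs.v *)
From HB Require Import structures.
From mathcomp Require Import all_boot all_order all_algebra.
From mathcomp Require Import complex.
From mathcomp Require Import all_classical all_reals all_analysis.

Set Implicit Arguments.
Unset Strict Implicit.
Unset Printing Implicit Defensive.

Import Order.TTheory GRing.Theory Num.Theory.
Import numFieldNormedType.Exports.

Local Open Scope classical_set_scope.
Local Open Scope ring_scope.
Local Open Scope complex_scope.

Section BoundedLinear.
Variables (R : realType) (X Y : normedModType R[i]).

(* The order of [R[i]] only relates numbers differing by a real, so the bound
   forces [M] to be a nonnegative real unless [X] is trivial. *)
Definition bounded_linear_pred : {pred X -> Y} :=
  fun f => `[< linear f /\ exists M : R[i], forall x, `|f x| <= M * `|x| >].

Record blinear := BLinear {
  blinear_fun :> X -> Y;
  blinear_funP : blinear_fun \in bounded_linear_pred }.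

HB.instance Definition _ := [isSub for blinear_fun].
HB.instance Definition _ := [Choice of blinear by <:].

Lemma bounded_linear_submod_closed : submod_closed bounded_linear_pred.
Proof.
split=> [|a f g /asboolP[lf [M Mf]] /asboolP[lg [N Ng]]]; apply/asboolP.
  split; first by move=> a x y; rewrite scaler0 addr0.
  by exists 0 => x; rewrite normr0 mul0r.
split.
  move=> b x y; rewrite !fctE /= lf lg !scalerDr !scalerA (mulrC a b).
  by rewrite addrACA.
exists (`|a| * M + N) => x; rewrite !fctE /= mulrDl -mulrA.
rewrite (le_trans (ler_normD _ _))// lerD// normrZ ler_wpM2l//.
Qed.

HB.instance Definition _ := GRing.isSubmodClosed.Build R[i] (X -> Y)
  bounded_linear_pred bounded_linear_submod_closed.
HB.instance Definition _ := [SubChoice_isSubLmodule of blinear by <:].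

Lemma blinearDE (f g : blinear) x : (f + g) x = f x + g x.
Proof. by []. Qed.

Lemma blinearZE a (f : blinear) x : (a *: f) x = a *: f x.
Proof. by []. Qed.

Lemma blinear_is_linear (f : blinear) : linear f.
Proof. by have /asboolP[] := blinear_funP f. Qed.

HB.instance Definition _ (f : blinear) :=
  GRing.isLinear.Build R[i] X Y *:%R f (@blinear_is_linear f).

Lemma blinearP (f g : blinear) : f =1 g -> f = g.
Proof. by move=> /funext fg; exact: val_inj. Qed.

(* Norms over [R[i]] are [R[i]]-valued, whereas [sup] lives in [R]. *)
Definition opnorm (f : blinear) : R[i] :=
  (sup [set complex.Re `|f x| | x in [set x : X | `|x| <= 1]])%:C.

Lemma Re_ge0K (z : R[i]) : 0 <= z -> (complex.Re z)%:C = z.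
Proof. by case: z => a b; rewrite lecE /= => /andP[/eqP -> _]. Qed.

Lemma opnorm_has_sup (f : blinear) :
  has_sup [set complex.Re `|f x| | x in [set x : X | `|x| <= 1]].
Proof.
have /asboolP[_ [M Mf]] := blinear_funP f; split.
  by exists (complex.Re `|f 0|), 0 => //=; rewrite normr0.
have [x1|x1] := pselect (exists x : X, x != 0); last first.
  exists 0 => _ [x _ <-]; have [->|x0] := eqVneq x 0.
    by rewrite raddf0 normr0.
  by exfalso; apply: x1; exists x.
have M0 : 0 <= M.
  case: x1 => x x0; have := le_trans (normr_ge0 _) (Mf x).
  by rewrite pmulr_lge0// normr_gt0.
exists (complex.Re M) => _ [x /= x1' <-].
rewrite -lecR !Re_ge0K// (le_trans (Mf x))//.
by rewrite -[leRHS]mulr1 ler_wpM2l.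
Qed.

Lemma opnorm_ge0 (f : blinear) : 0 <= opnorm f.
Proof.
rewrite /opnorm lecR; apply: le_trans (sup_ubound (proj2 (opnorm_has_sup f)) _).
  2: by exists 0 => //=; rewrite normr0.
by rewrite raddf0 normr0.
Qed.

Lemma opnormP (f : blinear) x : `|f x| <= opnorm f * `|x|.
Proof.
have [->|x0] := eqVneq x 0; first by rewrite raddf0 !normr0 mulr0.
rewrite -ler_pdivrMr ?normr_gt0//.
have -> : `|f x| / `|x| = `|f (`|x|^-1 *: x)|.
  by rewrite linearZ normrZ normfV normr_id mulrC.
rewrite -[leLHS]Re_ge0K// lecR; apply: sup_ubound (proj2 (opnorm_has_sup f)) _ _.
exists (`|x|^-1 *: x) => //=.
by rewrite normrZ normfV normr_id mulVf ?normr_eq0.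
Qed.

Lemma opnorm_le (f : blinear) (M : R[i]) :
  0 <= M -> (forall x, `|f x| <= M * `|x|) -> opnorm f <= M.
Proof.
move=> M0 Mf; rewrite -[leRHS]Re_ge0K// lecR; apply: ge_sup.
  by case: (opnorm_has_sup f).
move=> _ [x /= x1 <-]; rewrite -lecR !Re_ge0K// (le_trans (Mf x))//.
by rewrite -[leRHS]mulr1 ler_wpM2l.
Qed.

Lemma opnormD (f g : blinear) : opnorm (f + g) <= opnorm f + opnorm g.
Proof.
apply: opnorm_le => [|x]; first by rewrite addr_ge0 ?opnorm_ge0.
by rewrite mulrDl blinearDE (le_trans (ler_normD _ _))// lerD ?opnormP.
Qed.

Lemma opnormZ (a : R[i]) (f : blinear) : opnorm (a *: f) = `|a| * opnorm f.
Proof.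
have leZ b (g : blinear) : opnorm (b *: g) <= `|b| * opnorm g.
  apply: opnorm_le => [|x]; first by rewrite mulr_ge0 ?opnorm_ge0.
  by rewrite blinearZE normrZ -mulrA ler_wpM2l ?opnormP.
apply/eqP; rewrite eq_le leZ/=.
have [->|a0] := eqVneq a 0; first by rewrite normr0 mul0r opnorm_ge0.
rewrite -ler_pdivlMl ?normr_gt0//.
by rewrite -normfV -{1}[f](scalerK a0) leZ.
Qed.

Lemma opnorm0_eq0 (f : blinear) : opnorm f = 0 -> f = 0.
Proof.
move=> f0; apply: blinearP => x.
by apply/eqP; rewrite -normr_le0 (le_trans (opnormP f x))// f0 mul0r.
Qed.

HB.instance Definition _ :=
  Lmodule_isNormed.Build R[i] blinear opnormD opnormZ opnorm0_eq0.

End BoundedLinear.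

(* [R[i]^o] is the scalar field seen as a normed module over itself. *)
Notation dual X := (blinear X (_[i])^o).

Section Operators.
Variable R : realType.
Implicit Types X Y Z : normedModType R[i].

Lemma blid_proof X : (@idfun X : X -> X) \in @bounded_linear_pred R X X.
Proof. by apply/asboolP; split=> //; exists 1 => x; rewrite mul1r. Qed.

Definition blid X : blinear X X := BLinear (blid_proof X).

Lemma blcomp_proof X Y Z (g : blinear Y Z) (f : blinear X Y) :
  (g \o f : X -> Z) \in @bounded_linear_pred R X Z.
Proof.
apply/asboolP; split=> [a x y|]; first by rewrite /= !linearP.
exists (opnorm g * opnorm f) => x /=.
by rewrite (le_trans (opnormP g _))// -mulrA ler_wpM2l ?opnorm_ge0 ?opnormP.
Qed.

Definition blcomp X Y Z (g : blinear Y Z) (f : blinear X Y) : blinear X Z :=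
  BLinear (blcomp_proof g f).

Lemma transpose_proof X (T : blinear X X) :
  (fun f : dual X => blcomp f T) \in @bounded_linear_pred R (dual X) (dual X).
Proof.
apply/asboolP; split=> [a f g|]; first exact: blinearP.
exists (opnorm T) => f; apply: opnorm_le.
  by rewrite mulr_ge0 ?opnorm_ge0.
move=> x; rewrite (le_trans (opnormP f _))// (mulrC (opnorm T)) -mulrA.
by rewrite ler_wpM2l ?opnorm_ge0 ?opnormP.
Qed.

Definition transpose X (T : blinear X X) : blinear (dual X) (dual X) :=
  BLinear (transpose_proof T).

Lemma bidual_embedding_proof X (x : X) :
  (fun f : dual X => f x : R[i]^o) \in @bounded_linear_pred R (dual X) R[i]^o.
Proof.
by apply/asboolP; split=> //; exists `|x| => f; rewrite mulrC opnormP.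
Qed.

Definition bidual_embedding X (x : X) : dual (dual X) :=
  BLinear (bidual_embedding_proof x).

Definition reflexive_space X : Prop :=
  forall Phi : dual (dual X), exists x : X, bidual_embedding x = Phi.

Definition smooth_space X : Prop :=
  forall x : X, `|x| = 1 -> exists! f : dual X, `|f| = 1 /\ f x = 1.

(* The default value 0 is never used on a smooth space: see [duality_mapP] and
   [duality_map_uniq]. *)
Definition duality_map X (x : X) : dual X :=
  xget 0 [set f : dual X | `|f| = `|x| /\ f x = `|x| ^+ 2].

Lemma duality_map_exists_unique X (x : X) : smooth_space X ->
  exists! f : dual X, `|f| = `|x| /\ f x = `|x| ^+ 2.
Proof.
move=> sX; have [->|x0] := eqVneq x 0.
  exists 0; split; first by rewrite !normr0 expr0n.
  by move=> f [/eqP + _]; rewrite normr0 normr_eq0 => /eqP.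
have nx0 : `|x| != 0 by rewrite normr_eq0.
have [|f [[f1 fx] fu]] := sX (`|x|^-1 *: x).
  by rewrite normrZ normfV normr_id mulVf.
exists (`|x| *: f); split.
  rewrite normrZ f1 normr_id mulr1; split=> //.
  rewrite blinearZE -[x in f x](scalerKV nx0) linearZ/= fx.
  by rewrite -[_ *: (_ *: _)]/(_ * (_ * _)) mulr1 expr2.
move=> g [g1 gx]; rewrite (fu (`|x|^-1 *: g)) ?scalerKV//; split.
  by rewrite normrZ g1 normfV normr_id; exact: mulVf.
rewrite blinearZE linearZ/= gx.
suff : `|x|^-1 * (`|x|^-1 * `|x| ^+ 2) = 1 by [].
by rewrite expr2 mulKf// mulVf.
Qed.

Lemma duality_mapP X (x : X) : smooth_space X ->
  `|duality_map x| = `|x| /\ duality_map x x = `|x| ^+ 2.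
Proof.
move=> /(duality_map_exists_unique x)[f [fP _]].
exact: (@xgetPex _ 0 [set f : dual X | _] (ex_intro _ f fP)).
Qed.

Lemma duality_map_uniq X (x : X) (f : dual X) : smooth_space X ->
  `|f| = `|x| -> f x = `|x| ^+ 2 -> duality_map x = f.
Proof.
move=> sX f1 fx; have [g [_ gu]] := duality_map_exists_unique x sX.
by rewrite -(gu f)// -(gu (duality_map x))//; exact: duality_mapP.
Qed.

Definition normal_op X (T : blinear X X) : Prop :=
  forall x : X, `|T x| = `|transpose T (duality_map x)|.

Definition spectrum X (T : blinear X X) : set R[i] :=
  [set lambda | ~ exists S : blinear X X,
     blcomp S (T - lambda *: blid X) = blid X /\
     blcomp (T - lambda *: blid X) S = blid X].

Definition bounded_below X (T : blinear X X) : Prop :=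
  exists2 c : R[i], 0 < c & forall x, c * `|x| <= `|T x|.

Definition approximate_spectrum X (T : blinear X X) : set R[i] :=
  [set lambda | ~ bounded_below (T - lambda *: blid X)].

End Operators.

(* Main.v *)
From HB Require Import structures.
Require Import Defs.
From mathcomp Require Import all_boot all_order all_algebra.
From mathcomp Require Import complex ring.
From mathcomp Require Import all_classical all_reals all_analysis.

(** Write [S] for [T - lambda] and suppose that [S] is bounded below. Completeness
    of [X] makes the range of [S] closed, so [S] is invertible as soon as its range
    is dense ([bounded_below_dense_surjective], [bounded_below_surjective_invertible]).
    As [lambda] is in the spectrum, the range is not dense, and the Hahn-Banach
    theorem gives a nonzero functional [f] that vanishes on it, that is,
    [transpose S f = 0] ([hahn_banach_separation]).

    On a reflexive smooth space the duality map is onto ([duality_map_surjective]):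
    by reflexivity [f] attains its norm at a unit vector, and a suitable multiple
    [x] of that vector has [J x = f] because [J x] is the only functional with the
    two properties that define it. Normality of [S] now gives
    [`|S x| = `|transpose S (J x)| = 0]. Since [S] is bounded below, [x = 0], hence
    [f = J x = 0], a contradiction.

    The Hahn-Banach theorem is obtained from minimal sublinear functionals. Zorn's
    lemma gives a minimal sublinear functional below a given one
    ([minimal_sublinear]), and a minimal one is linear. The constraints to be met by
    the linear functional, here to vanish on a subspace and to be large at a point,
    are put into the sublinear functional from which one starts
    ([sublinear_cone]), so that no functional defined on a subspace has to be
    extended. *)

Set Implicit Arguments.
Unset Strict Implicit.
Unset Printing Implicit Defensive.

Import Order.TTheory GRing.Theory Num.Theory.
Import numFieldNormedType.Exports.

Local Open Scope ring_scope.

(** * The Hahn-Banach theorem for sublinear functionals *)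

Section SublinearFunctionals.
Local Open Scope classical_set_scope.
Variables (R : realType) (V : lmodType R).
Implicit Types (p q : V -> R) (x y : V).

(** The inequality in the homogeneity clause is equivalent to equality
    ([sublinearZ]); it is the form that passes to infima. *)
Definition sublinear q : Prop :=
  (forall x y, q (x + y) <= q x + q y) /\
  (forall t x, 0 <= t -> q (t *: x) <= t * q x).

Lemma sublinear0 q : sublinear q -> q 0 = 0.
Proof.
move=> [qD qZ]; apply/eqP; rewrite eq_le; apply/andP; split.
  by have := qZ 0 0 (lexx _); rewrite scaler0 mul0r.
by have := qD 0 0; rewrite addr0 lerDl.
Qed.

Lemma sublinear_ge q x : sublinear q -> - q (- x) <= q x.
Proof.
move=> sq; have := sq.1 x (- x).
by rewrite subrr (sublinear0 sq) -lerBlDr sub0r.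
Qed.

Lemma sublinearZ q t x : sublinear q -> 0 <= t -> q (t *: x) = t * q x.
Proof.
move=> sq; rewrite le_eqVlt => /predU1P[<-|t0].
  by rewrite scale0r mul0r sublinear0.
apply/eqP; rewrite eq_le (sq.2 _ _ (ltW t0))/= -ler_pdivlMl//.
rewrite -{1}[x](scalerK (lt0r_neq0 t0)); apply: sq.2.
by rewrite invr_ge0 ltW.
Qed.

(** The two stability hypotheses compare each inequality with a member of [F] that
    may depend on the points. In this form they hold both for a chain of sublinear
    functionals, where the smaller of two members is taken, and for the translates
    in [sublinear_cone], where the translations are added. *)
Lemma sublinear_inf (F : set (V -> R)) :
  F !=set0 -> (forall x, has_lbound [set f x | f in F]) ->
  (forall f g x y, F f -> F g -> exists2 h, F h & h (x + y) <= f x + g y) ->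
  (forall f t x, F f -> 0 <= t -> exists2 h, F h & h (t *: x) <= t * f x) ->
  sublinear (fun x => inf [set f x | f in F]).
Proof.
move=> [f0 Ff0] lbF FD FZ.
have infle f x : F f -> inf [set h x | h in F] <= f x.
  by move=> Ff; apply: ge_inf => //; exists f.
have leinf x c : (forall f, F f -> c <= f x) -> c <= inf [set f x | f in F].
  move=> cF; apply: lb_le_inf; first by exists (f0 x), f0.
  by move=> _ [f Ff <-]; exact: cF.
split=> [x y|t x t0].
  rewrite -lerBlDr; apply: (leinf) => f Ff.
  rewrite lerBlDr -lerBlDl; apply: leinf => g Fg; rewrite lerBlDl.
  by have [h Fh] := FD f g x y Ff Fg; apply: le_trans; exact: infle.
move: t0; rewrite le_eqVlt => /predU1P[<-|t0].
  have [h Fh] := FZ f0 0 x Ff0 (lexx _).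
  by rewrite !mul0r; apply: le_trans; exact: infle.
rewrite -ler_pdivrMl//; apply: leinf => f Ff; rewrite ler_pdivrMl//.
by have [h Fh] := FZ f t x Ff (ltW t0); apply: le_trans; exact: infle.
Qed.

(** A linear [g <= q] with [t <= g v] for every [(v, t)] in [K] satisfies
    [g x = g (x + v) - g v <= q (x + v) - t]. The functional [p] is the infimum of
    these bounds, which is finite because [t <= q v] on [K]. Conversely its value at
    [- v] forces [t <= g v] for every linear [g <= p]. *)
Lemma sublinear_cone q (K : set (V * R)) : sublinear q ->
  K (0, 0) -> (forall k l, K k -> K l -> K (k.1 + l.1, k.2 + l.2)) ->
  (forall k t, K k -> 0 <= t -> K (t *: k.1, t * k.2)) ->
  (forall k, K k -> k.2 <= q k.1) ->
  exists p, [/\ sublinear p, forall x, p x <= q x &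
    forall k, K k -> p (- k.1) <= - k.2].
Proof.
move=> sq K0 KD KZ Kq.
pose F := [set (fun x => q (x + k.1) - k.2) | k in K].
have lbF x : has_lbound [set f x | f in F].
  exists (- q (- x)) => _ [_ [k Kk <-] <-].
  rewrite lerBrDr addrC lerBlDr (le_trans (Kq _ Kk))//.
  by have := sq.1 (x + k.1) (- x); rewrite addrAC subrr add0r.
have infle k x : K k -> inf [set h x | h in F] <= q (x + k.1) - k.2.
  move=> Kk; apply: ge_inf => //.
  by exists (fun x => q (x + k.1) - k.2) => //; exists k.
exists (fun x => inf [set f x | f in F]); split.
- apply: sublinear_inf => //.
  + by exists (fun x => q (x + 0) - 0); exists (0, 0).
  + move=> _ _ x y [k Kk <-] [l Kl <-].
    exists (fun x => q (x + (k.1 + l.1)) - (k.2 + l.2)).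
      by exists (k.1 + l.1, k.2 + l.2) => //; exact: KD.
    rewrite addrACA opprD [leRHS]addrACA lerD2r; exact: sq.1.
  + move=> _ t x [k Kk <-] t0.
    exists (fun x => q (x + (t *: k.1)) - (t * k.2)).
      by exists (t *: k.1, t * k.2) => //; exact: KZ.
    by rewrite -scalerDr mulrBr lerD2r; exact: sq.2.
- by move=> x; have := infle _ x K0; rewrite addr0 subr0.
- by move=> k Kk; have := infle _ (- k.1) Kk; rewrite addNr (sublinear0 sq) sub0r.
Qed.

(** A lower bound of a nonempty chain is its pointwise infimum, which is finite
    since every sublinear [q <= p] is at least [- p (- x)] at [x]. *)
Lemma minimal_sublinear p : sublinear p ->
  exists q, [/\ sublinear q, forall x, q x <= p x &
    forall r, sublinear r -> (forall x, r x <= q x) -> r = q].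
Proof.
move=> sp; pose T := {q : V -> R | sublinear q /\ forall x, q x <= p x}.
pose below (q r : T) : bool := `[< forall x, sval r x <= sval q x >].
have [|q1 q2 q3 /asboolP h /asboolP k|[q1 h1] [q2 h2] /asboolP/= h /asboolP/= k
     |A totA|[q [sq qp]] qmin] := @Zorn T below.
- by move=> q; apply/asboolP.
- by apply/asboolP => x; exact: le_trans (k x) (h x).
- have e : q1 = q2 by apply/funext => x; apply/eqP; rewrite eq_le h k.
  by subst q2; congr exist; exact: Prop_irrelevance.
- have [[q0 Aq0]|A0] := pselect (A !=set0); last first.
    exists (exist _ p (conj sp (fun=> lexx _))) => q Aq.
    by exfalso; apply: A0; exists q.
  pose F := [set sval q | q in A].
  have lbF x : has_lbound [set f x | f in F].
    exists (- p (- x)) => _ [_ [[q [sq qp]] _ <-] <-] /=.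
    by rewrite (le_trans _ (sublinear_ge _ sq))// lerN2.
  have infle (q : T) x : A q -> inf [set f x | f in F] <= sval q x.
    by move=> Aq; apply: ge_inf => //; exists (sval q) => //; exists q.
  have sF : sublinear (fun x => inf [set f x | f in F]).
    apply: sublinear_inf => //.
    + by exists (sval q0), q0.
    + move=> _ _ x y [q Aq <-] [r Ar <-].
      have [/asboolP h|/asboolP h] := totA _ _ Aq Ar.
        exists (sval r); first by exists r.
        have [[sr _] _] := svalP r; apply: le_trans (sr _ _) _.
        by rewrite lerD2r.
      exists (sval q); first by exists q.
      have [[sr _] _] := svalP q; apply: le_trans (sr _ _) _.
      by rewrite lerD2l.
    + move=> _ t x [q Aq <-] t0; exists (sval q); first by exists q.
      by have [[_ sr] _] := svalP q; exact: sr.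
  have Fp x : inf [set f x | f in F] <= p x.
    by apply: le_trans (infle _ x Aq0) _; have [_] := svalP q0.
  exists (exist _ (fun x => inf [set f x | f in F]) (conj sF Fp)) => q Aq; apply/asboolP => x; exact: infle.
- exists q; split=> // r sr rq.
  have rp x : r x <= p x by exact: le_trans (rq x) (qp x).
  suff /qmin[] : below (exist _ q (conj sq qp)) (exist _ r (conj sr rp)) by [].
  exact/asboolP.
Qed.

(** Apply [sublinear_cone] to the ray through [(y, q y)]: the functional obtained
    is below [q], hence equal to [q] by minimality, and its value at [- y] is at most
    [- q y]. So [q] is odd, and an odd sublinear functional is linear. *)
Lemma minimal_sublinear_linear q : sublinear q ->
  (forall r, sublinear r -> (forall x, r x <= q x) -> r = q) ->
  linear (q : V -> R^o).
Proof.
move=> sq qmin.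
have qN y : q (- y) = - q y.
  pose K := [set (t *: y, t * q y) | t in [set t : R | 0 <= t]].
  have [||||r [sr rq rK]] := @sublinear_cone q K sq.
  - by exists 0 => //=; rewrite scale0r mul0r.
  - move=> _ _ [s /= s0 <-] [t /= t0 <-]; exists (s + t) => /=.
      by rewrite addr_ge0.
    by rewrite scalerDl mulrDl.
  - move=> _ t [s /= s0 <-] t0; exists (t * s) => /=; first by rewrite mulr_ge0.
    by rewrite scalerA mulrA.
  - by move=> _ [t /= t0 <-]; rewrite sublinearZ.
  have := rK (1 *: y, 1 * q y) (ex_intro2 _ _ 1 ler01 erefl).
  rewrite /= scale1r mul1r (qmin r sr rq) => qNy.
  by apply/eqP; rewrite eq_le qNy lerNl sublinear_ge.
have qD x y : q (x + y) = q x + q y.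
  apply/eqP; rewrite eq_le sq.1/=.
  by have := sq.1 (x + y) (- y); rewrite addrK qN lerBrDr.
move=> t x y; rewrite qD; congr (_ + _).
have [t0|t0] := leP 0 t; first exact: sublinearZ.
by rewrite -[t *: x]opprK qN -scaleNr sublinearZ ?oppr_ge0 ?ltW// mulNr opprK.
Qed.

(** A pair [(v, t)] in [K] stands for the constraint [t <= g v] on the functional
    [g]. As [g <= q], such a constraint can only be met if [t <= q v]; on a convex
    cone of constraints this necessary condition is also sufficient. *)
Lemma hahn_banach_cone q (K : set (V * R)) : sublinear q ->
  K (0, 0) -> (forall k l, K k -> K l -> K (k.1 + l.1, k.2 + l.2)) ->
  (forall k t, K k -> 0 <= t -> K (t *: k.1, t * k.2)) ->
  (forall k, K k -> k.2 <= q k.1) ->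
  exists g : V -> R^o, [/\ linear g, forall x, g x <= q x &
    forall k, K k -> k.2 <= g k.1].
Proof.
move=> sq K0 KD KZ Kq.
have [p [sp pq pK]] := sublinear_cone sq K0 KD KZ Kq.
have [g [sg gp gmin]] := minimal_sublinear sp.
have lg := minimal_sublinear_linear sg gmin.
exists g; split=> // [x|k Kk]; first exact: le_trans (gp x) (pq x).
rewrite -[k.1]opprK; apply: le_trans (sublinear_ge _ sg).
by rewrite opprK lerNr (le_trans (gp _))// pK.
Qed.

End SublinearFunctionals.

(** * Separation in complex normed spaces *)

Section RestrictionOfScalars.
Local Open Scope complex_scope.
Variable R : realType.

(** An alias, so that the real module structure does not compete with the complex
    one on the same carrier. *)
Definition realify (V : lmodType R[i]) : Type := V.

HB.instance Definition _ (V : lmodType R[i]) := GRing.Zmodule.on (realify V).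

Section Scale.
Variable V : lmodType R[i].

Definition rscale (t : R) (x : realify V) : realify V := t%:C *: (x : V).

Fact rscaleA a b v : rscale a (rscale b v) = rscale (a * b) v.
Proof. by rewrite /rscale scalerA -rmorphM. Qed.
Fact rscale1 : left_id 1 rscale.
Proof. by move=> v; rewrite /rscale scale1r. Qed.
Fact rscaleDr : right_distributive rscale +%R.
Proof. by move=> a u v; exact: scalerDr. Qed.
Fact rscaleDl v : {morph rscale^~ v : a b / a + b}.
Proof. by move=> a b; rewrite /rscale raddfD; exact: scalerDl. Qed.

HB.instance Definition _ := GRing.Zmodule_isLmodule.Build R (realify V)
  rscaleA rscale1 rscaleDr rscaleDl.
End Scale.

Lemma realify_scaleE (V : lmodType R[i]) t (x : V) :
  t *: (x : realify V) = t%:C *: x.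
Proof. by []. Qed.

End RestrictionOfScalars.

Section ComplexFunctionals.
Local Open Scope classical_set_scope.
Local Open Scope complex_scope.
Variable R : realType.

Lemma Re_normC (z : R[i]) : complex.Re z <= complex.Re `|z|.
Proof.
rewrite -lecR [leRHS]Re_ge0K//; apply: le_trans (normc_ge_Re z).
by rewrite lecR ler_norm.
Qed.

(** The disc of radius [r] meets the half-plane [r <= Re z] only at [r]. *)
Lemma Re_eq_norm (z : R[i]) (r : R) :
  `|z| <= r%:C -> r <= complex.Re z -> z = r%:C.
Proof.
case: z => a b zr /= ra; have ar : a <= r.
  have := le_trans (Re_normC (a +i* b)) _; apply.
  by rewrite -lecR Re_ge0K.
have {ar ra} ra : r = a by apply/eqP; rewrite eq_le ra ar.
subst r; congr (_ +i* _)%C; apply/eqP; rewrite -sqrf_eq0 eq_le sqr_ge0 andbT.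
have : `|(a +i* b)%C| ^+ 2 <= a%:C ^+ 2.
  by rewrite lerXn2r// nnegrE// (le_trans _ zr).
by rewrite -add_Re2_Im2 -rmorphXn lecR /= -subr_ge0 opprD addNKr oppr_ge0.
Qed.

Lemma phase_exists (z : R[i]) : exists2 u : R[i], `|u| = 1 & u * z = `|z|.
Proof.
have [->|z0] := eqVneq z 0; first by exists 1; rewrite ?normr1 ?mulr0 ?normr0.
have nz0 : `|z| != 0 by rewrite normr_eq0.
exists (`|z| / z); last by rewrite mulfVK.
by rewrite normf_div normr_id divff.
Qed.

(** A complex functional is determined by its real part, through
    [f x = g x - i g (i x)]. The bound on [g] passes to [f] without loss because a
    unimodular multiple of [x] makes the value of [f] real and nonnegative. *)
Lemma complexify_functional (V : normedModType R[i]) (g : realify V -> R^o) :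
  linear g -> (forall x : V, g x <= complex.Re `|x|) ->
  exists f : dual V, [/\ forall x, f x = (g x +i* - g ('i%C *: x))%C &
    forall x, `|f x| <= `|x|].
Proof.
move=> lg gle; pose f (x : V) : R[i]^o := (g x +i* - g ('i%C *: x))%C.
have gD x y : g (x + y) = g x + g y.
  by have := lg 1 x y; rewrite !scale1r.
have gZ t (x : V) : g (t%:C *: x) = t * g x.
  have g0 : g 0 = 0 by apply: (@addrI _ (g 0)); rewrite -gD !addr0.
  by have := lg t x 0; rewrite addr0 g0 addr0.
have gN x : g (- x) = - g x.
  by have := gZ (-1) x; rewrite rmorphN1 scaleN1r mulN1r.
have decomp s r (x : V) : (s +i* r)%C *: x = s%:C *: x + r%:C *: ('i%C *: x).
  rewrite scalerA -scalerDl; congr (_ *: _).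
  by apply/eqP; rewrite eq_complex /=; apply/andP; split; apply/eqP; ring.
have fZ a x : f (a *: x) = a * f x.
  case: a => s r; rewrite /f decomp scalerDr !gD !gZ.
  have -> : 'i%C *: (s%:C *: x) = s%:C *: ('i%C *: x) by rewrite !scalerA mulrC.
  have -> : 'i%C *: (r%:C *: ('i%C *: x)) = r%:C *: (- x).
    by rewrite !scalerA -scaleN1r scalerA mulrC mulrA -sqr_i expr2 mulrC mulrA.
  rewrite !gZ gN.
  by apply/eqP; rewrite eq_complex /=; apply/andP; split; apply/eqP; ring.
have lf : linear f.
  move=> a x y; have -> : a *: f x = f (a *: x) by rewrite fZ.
  by rewrite /f scalerDr !gD opprD.
have fle x : `|f x| <= `|x|.
  have [u u1 fu] := phase_exists (f x).
  have fux : f (u *: x) = `|f x| by rewrite fZ.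
  have -> : `|f x| = (g (u *: x))%:C by rewrite -fux -[LHS]Re_ge0K// fux.
  by rewrite -(Re_ge0K (normr_ge0 x)) lecR (le_trans (gle _))// normrZ u1 mul1r.
have bf : f \in @bounded_linear_pred R V R[i]^o.
  by apply/asboolP; split=> //; exists 1 => x; rewrite mul1r.
by exists (BLinear bf).
Qed.

(** The constraints imposed on the real part of [f] are [t * d <= Re (f (t y + m))]
    for [t >= 0] and [m] in [M]. The norm satisfies them because [y] is at distance
    at least [d] from [M]. For [t = 0] they say that [Re f] is nonnegative on the
    subspace [M], hence zero. With [M] reduced to [0] and [d] the norm of [y], the
    lemma gives a norming functional of [y]. *)
Lemma hahn_banach_separation (V : normedModType R[i]) (M : set V) (y : V)
    (d : R) :
  M 0 -> (forall a x z, M x -> M z -> M (a *: x + z)) ->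
  (forall m, M m -> d <= complex.Re `|y - m|) ->
  exists f : dual V, [/\ forall x, `|f x| <= `|x|,
    forall m, M m -> f m = 0 & d <= complex.Re (f y)].
Proof.
move=> M0 Mlin dM.
have MZ a x : M x -> M (a *: x).
  by move=> Mx; rewrite -[_ *: _]addr0; exact: Mlin.
have MD x z : M x -> M z -> M (x + z).
  by move=> Mx Mz; rewrite -[x]scale1r; exact: Mlin.
pose q (x : realify V) : R := complex.Re `|(x : V)|.
have sq : sublinear q.
  split=> [x z|t x t0]; rewrite /q.
    by rewrite -raddfD -lecR !Re_ge0K ?addr_ge0// ler_normD.
  by rewrite normrZ ger0_norm ?lecR//; case: (`|_|) => a b /=; rewrite mul0r subr0.
pose K : set (realify V * R) :=
  [set k | exists t m, [/\ 0 <= t, M m & k = (t%:C *: y + m, t * d)]].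
have [||||g [lg gq gK]] := @hahn_banach_cone R (realify V) q K sq.
- by exists 0, 0; rewrite scale0r addr0 mul0r.
- move=> _ _ [s [m [s0 Mm ->]]] [t [n [t0 Mn ->]]]; exists (s + t), (m + n).
  split; [exact: addr_ge0|exact: MD|].
  by rewrite /= mulrDl rmorphD/= scalerDl; congr (_, _); rewrite addrACA.
- move=> _ t [s [m [s0 Mm ->]]] t0; exists (t * s), (t%:C *: m).
  split; [exact: mulr_ge0|exact: MZ|].
  by rewrite /= mulrA rmorphM/= realify_scaleE scalerDr scalerA.
- move=> _ [t [m [t0 Mm ->]]] /=; move: t0; rewrite le_eqVlt => /predU1P[<-|t0].
    by rewrite mul0r /q -lecR [leRHS]Re_ge0K; exact: normr_ge0.
  have ti0 : 0 <= t^-1 by rewrite invr_ge0 ltW.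
  rewrite -ler_pdivlMl// -(sublinearZ _ sq ti0) realify_scaleE scalerDr scalerA.
  rewrite -rmorphM mulVf ?lt0r_neq0// scale1r -[_ *: m]opprK.
  by apply: dM; rewrite -scaleN1r; exact/MZ/MZ.
have [f [fE fle]] := complexify_functional lg gq.
have gM m : M m -> g m = 0.
  have g0 m' : M m' -> 0 <= g m'.
    move=> Mm; have := gK (m', 0); apply; exists 0, m'.
    by rewrite scale0r add0r mul0r.
  move=> Mm; apply/eqP; rewrite eq_le g0// andbT.
  have gN : g (- m) = - g m.
    have gD u v : g (u + v) = g u + g v by have := lg 1 u v; rewrite !scale1r.
    apply: (@addrI _ (g m)); rewrite -gD !subrr; apply: (@addrI _ (g 0)).
    by rewrite -gD !addr0.
  by rewrite -oppr_ge0 -gN g0// -scaleN1r; exact: MZ.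
exists f; split=> // [m Mm|].
  by rewrite fE !gM ?oppr0//; exact: MZ.
rewrite fE /=; have := gK (y, d); apply; exists 1, 0.
by rewrite scale1r addr0 mul1r.
Qed.

End ComplexFunctionals.

(** * The duality map of a reflexive smooth space *)

Section DualityMap.
Local Open Scope classical_set_scope.

Lemma duality_map_surjective (R : realType) (X : normedModType R[i]) (f : dual X) :
  reflexive_space X -> smooth_space X -> exists x : X, duality_map x = f.
Proof.
move=> reflX smoothX.
have [|||Phi [Phile _ Phif]] :=
    @hahn_banach_separation R (dual X) [set 0] f (complex.Re `|f|).
- by [].
- by move=> a x z /= -> ->; rewrite scaler0 addr0.
- by move=> m /= ->; rewrite subr0.
have [x xPhi] := reflX Phi.
have evx (h : dual X) : h x = Phi h by rewrite -xPhi.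
have [Jx Jxx] := duality_mapP x smoothX.
(* The embedding into the bidual does not decrease norms, since [J x] attains
   [`|x|] at [x]. *)
have x1 : `|x| <= 1.
  have [->|x0] := eqVneq x 0; first by rewrite normr0 ler01.
  have nx0 : 0 < `|x| by rewrite normr_gt0.
  rewrite -(ler_pM2r nx0) mul1r -expr2 -[leLHS]ger0_norm ?exprn_ge0//.
  by rewrite -Jxx evx -[leRHS]Jx Phile.
have fx : f x = `|f|.
  have fxle : `|f x| <= `|f| by rewrite evx Phile.
  by rewrite -[RHS]Re_ge0K//; apply: Re_eq_norm; rewrite ?Re_ge0K// evx.
exists (`|f| *: x).
have fz : f (`|f| *: x) = `|f| ^+ 2.
  by rewrite linearZ /= fx expr2.
have nz : `|f| = `|(`|f| *: x)|.
  apply/eqP; rewrite eq_le normrZ normr_id ler_piMr// andbT.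
  have [->|f0] := eqVneq f 0; first by rewrite normr0 mul0r.
  have nf0 : 0 < `|f| by rewrite normr_gt0.
  rewrite ler_pMr// -(ler_pM2l nf0) mulr1.
  by have := opnormP f x; rewrite fx normr_id.
by apply: duality_map_uniq => //; rewrite -nz.
Qed.

End DualityMap.

(** * Operators that are bounded below *)

Section BoundedBelow.
Local Open Scope classical_set_scope.
Local Open Scope complex_scope.
Variable R : realType.

Lemma bounded_below_surjective_invertible (X : normedModType R[i])
    (S : blinear X X) : bounded_below S ->
  (forall y, exists x, S x = y) ->
  exists U : blinear X X, blcomp U S = blid X /\ blcomp S U = blid X.
Proof.
move=> [c c0 cS] /choice[U SU].
have Sinj x x' : S x = S x' -> x = x'.
  move=> e; apply/eqP; rewrite -subr_eq0 -normr_le0 -(ler_pM2l c0) mulr0.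
  by rewrite (le_trans (cS _))// linearB/= e subrr normr0.
have bU : U \in @bounded_linear_pred R X X.
  apply/asboolP; split=> [a x z|]; first by apply: Sinj; rewrite linearP/= !SU.
  by exists c^-1 => x; rewrite ler_pdivlMl// -{2}[x]SU.
exists (BLinear bU); split; apply: blinearP => x /=; last exact: SU.
by apply: Sinj; rewrite SU.
Qed.

(** An operator that is bounded below on a Banach space has closed range: if [S x]
    approaches [y], then [x] itself converges. *)
Lemma bounded_below_dense_surjective (X : completeNormedModType R[i])
    (S : blinear X X) : bounded_below S ->
  (forall y (e : R), 0 < e -> exists x, `|y - S x| < e%:C) ->
  forall y, exists x, S x = y.
Proof.
move=> [c c0 cS] dense y.
pose B (e : R) : set X := [set x | `|y - S x| < e%:C].
pose F := filter_from [set e : R | 0 < e] B.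
have FF : ProperFilter F.
  apply: filter_from_proper => [|e /= e0]; last exact: dense.
  apply: filter_from_filter => [|d e /= d0 e0]; first by exists 1 => /=.
  exists (Num.min d e); rewrite /= ?lt_min ?d0//.
  by move=> x /= /lt_le_trans h; split; apply: h; rewrite lecR ge_min lexx ?orbT.
(* The lower bound turns closeness of images to [y] into closeness of preimages,
   which makes the filter of approximate solutions of [S x = y] Cauchy. *)
have close x x' : c * `|x - x'| <= `|y - S x| + `|y - S x'|.
  by rewrite (le_trans (cS _))// linearB/= (distrC y) ler_distD.
have cauchyF : cauchy F.
  apply: cauchy_exP => e e0.
  pose d := complex.Re (c * e / 2).
  have dE : d%:C = c * e / 2 by rewrite Re_ge0K// ltW// divr_gt0// mulr_gt0.
  have d0 : 0 < d by rewrite -ltcR dE divr_gt0// mulr_gt0.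
  have [x xd] := dense y d d0.
  exists x, d => //= x' x'd; rewrite -ball_normE /=.
  rewrite -(ltr_pM2l c0) (le_lt_trans (close _ _))//.
  by rewrite [ltRHS](splitr (c * e)) -dE ltrD.
(* Continuity of [S] shows that the limit of the filter solves [S x = y]. *)
have cvgF : cvg F by exact: cauchy_cvg.
have Fx d : 0 < d -> F [set x | `|lim F - x| < d].
  by move=> d0; exact: (@cvgr_dist_lt _ _ _ F _ id (lim F) cvgF).
exists (lim F); apply/esym/eqP; rewrite -subr_eq0 -normr_le0.
apply/ler_addgt0Pl => e e0; rewrite addr0.
have S0 : 0 < opnorm S + 1 by rewrite ltr_wpDl ?opnorm_ge0.
pose d := complex.Re (e / 2).
have dE : d%:C = e / 2 by rewrite Re_ge0K// ltW// divr_gt0.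
have d0 : 0 < d by rewrite -ltcR dE divr_gt0.
have [x [xd xlim]] : exists x,
    `|y - S x| < e / 2 /\ `|lim F - x| < e / 2 / (opnorm S + 1).
  have Bd : F (B d) by exists d.
  have [x [/= Bx xlim]] := filter_ex (filterI Bd (Fx (e / 2 / (opnorm S + 1))
    (divr_gt0 (divr_gt0 e0 (ltr0Sn _ 1)) S0))).
  by exists x; split=> //; rewrite -dE.
rewrite (splitr e) (le_trans (ler_distD (S x) _ _))//.
apply: lerD; first exact: ltW.
rewrite -linearB; apply: le_trans (opnormP _ _) _; rewrite distrC.
apply: (@le_trans _ _ ((opnorm S + 1) * `|lim F - x|)).
  by rewrite ler_wpM2r// lerDl.
by rewrite -ler_pdivlMl// mulrC ltW.
Qed.

End BoundedBelow.

Theorem theorem17 (R : realType) (X : completeNormedModType R[i])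
    (reflexiveX : reflexive_space X) (smoothX : smooth_space X)
    (T : blinear X X) (lambda : R[i])
    (lambda_sigma : spectrum T lambda)
    (normalT : normal_op (T - lambda *: blid X)) :
  approximate_spectrum T lambda.
Proof.
rewrite /approximate_spectrum /=; move: lambda_sigma normalT.
rewrite /spectrum /=; move: (T - _) => S Sninv normalS Sbelow.
apply: Sninv; apply: bounded_below_surjective_invertible => //.
apply: bounded_below_dense_surjective => // y e e0.
apply: contrapT => far.
have farS m : (range S)%classic m -> e <= complex.Re `|y - m|.
  move=> [x _ <-]; rewrite leNgt; apply/negP => lt.
  apply: far; exists x; rewrite -[ltLHS]Re_ge0K// ltcR//.
have [||f [_ fS fy]] := hahn_banach_separation _ _ farS.
- by exists 0 => //; rewrite linear0.
- by move=> a _ _ [x _ <-] [z _ <-]; exists (a *: x + z); rewrite ?linearP.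
(* The vector [x] at which [f] attains its norm lies in the kernel of [S]. *)
have [x Jx] := duality_map_surjective f reflexiveX smoothX.
have Sx0 : S x = 0.
  apply/normr0_eq0; rewrite normalS Jx.
  have -> : transpose S f = 0; last by rewrite normr0.
  by apply: blinearP => z /=; apply: fS; exists z.
have [c c0 cS] := Sbelow.
have x0 : x = 0.
  apply/eqP; rewrite -normr_le0 -(ler_pM2l c0) mulr0.
  by rewrite (le_trans (cS x))// Sx0 normr0.
have f0 : f = 0.
  by have [+ _] := duality_mapP x smoothX; rewrite Jx x0 normr0 => /normr0_eq0.
by move: fy; rewrite f0 /= leNgt e0.
Qed.
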